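(* Let $A$ be a ring. Let $B$ be an $A$-algebra. Let $n\in\mathbb{N}^{+}$. Let $v\in B$. Let $a_0,a_1,\ldots,a_n$ be $n+1$ elements of $A$ such that $\sum_{i=0}^{n}a_i v^i=0$. Let $k\in\{0,1,\ldots,n\}$. Then $\sum_{i=0}^{n-k}a_{i+k}v^i$ is $n$-integral over $A$.
   Context: All rings are commutative with unity, and ''$A$-algebra'' means commutative unital $A$-algebra (the structure map $A\to B$ need not be injective). $\mathbb{N}=\{0,1,2,\ldots\}$ and $\mathbb{N}^{+}=\{1,2,3,\ldots\}$. For a ring $A$, an $A$-algebra $B$ and $n\in\mathbb{N}$, an element $u\in B$ is called $n$-integral over $A$ if there exists a monic polynomial $P\in A[X]$ with $\deg P=n$ (that is, $P=X^n+\sum_{k=0}^{n-1}a_kX^k$ with $a_k\in A$) and $P(u)=0$. *)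

(* Defs.v *)
From mathcomp Require Import all_boot all_algebra.

Set Implicit Arguments.
Unset Strict Implicit.
Unset Printing Implicit Defensive.

Import GRing.Theory.
Local Open Scope ring_scope.

(* Rings may be trivial, hence comPzRingType.  MathComp's comAlgType and      *)
(* {poly _} both exclude the trivial ring, so an A-algebra is a ring B with   *)
(* its structure morphism A -> B, and a polynomial is given by its sequence   *)
(* of coefficients, constant term first (trailing zeros are permitted).       *)
(* Over nontrivial rings n_integralP recovers the formulation with {poly A}.  *)

(* P = X^n + P`_(n-1) X^(n-1) + ... + P`_0; in the trivial ring, where        *)
(* 1 = 0, this is taken formally: the size of P still records n.              *)
Definition monic_of_degree (A : comPzRingType) (n : nat) (P : seq A) : Prop :=
  size P = n.+1 /\ P`_n = 1.

Definition eval_in (A B : comPzRingType) (f : {rmorphism A -> B})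
    (P : seq A) (u : B) : B :=
  \sum_(i < size P) f P`_i * u ^+ i.

Definition n_integral (A B : comPzRingType) (f : {rmorphism A -> B})
    (n : nat) (u : B) : Prop :=
  exists2 P : seq A, monic_of_degree n P & eval_in f P u = 0.

Lemma n_integralP (A B : comNzRingType) (f : {rmorphism A -> B})
    (n : nat) (u : B) :
  n_integral f n u <->
  exists P : {poly A},
    [/\ P \is monic, size P = n.+1 & root (map_poly f P) u].
Proof.
have evalE (P : {poly A}) : (map_poly f P).[u] = eval_in f P u.
  rewrite (@horner_coef_wide _ (size P)) ?size_poly //.
  by apply: eq_bigr => i _; rewrite coef_map.
split=> [[P [sP Pn] Pu] | [P [/monicP mP sP /rootP Pu]]]; last first.
  by exists P; [split=> //; rewrite -mP lead_coefE sP | rewrite -evalE].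
have lP : last 1 P != 0 by rewrite (last_nth 0) sP /= -[nth _ _ _]/(P`_n) Pn oner_neq0.
exists (Polynomial lP); split=> //.
- by apply/monicP; rewrite lead_coefE /= sP.
- by apply/rootP; rewrite evalE.
Qed.

(* Main.v *)
Require Import Defs.
From HB Require Import structures.
From mathcomp Require Import all_boot all_algebra.
Import GRing.Theory.
Local Open Scope ring_scope.

(** Write [u] for the element [\sum_(i < (n - k).+1) f a`_(i + k) * v ^+ i].
    The proof is the determinant trick [n_integral_eigen] applied to the [A]-submodule [U] of [B]
    spanned by [1, v, ..., v ^+ n.-1]: as [U] contains [1] and is generated by
    [n] elements, stability of [U] under multiplication by [u] makes [u] a root
    of the characteristic polynomial of an [n] by [n] matrix over [A].

    Stability holds because the relation on [v] can be cut at degree [k]: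
    [v ^+ k * u] is the part of degree at least [k], so it is the opposite of
    [\sum_(i < k) f a`_i * v ^+ i].  In [u * v ^+ j], the defining expression
    of [u] gives powers of [v] of degree at most [n - k + j], which is less
    than [n] when [j < k]; when [k <= j < n], the other expression gives
    powers of degree less than [k + (j - k) = j].  By [sum_powers_span] these
    bounds on the degrees are all that membership in [U] requires.

    The characteristic polynomial is monic of degree [n] only over a nontrivial
    ring.  When [1 = 0] in [B] every element of [B] is zero and any formal monic polynomial
    vanishes at it; otherwise the morphism [f] forces [1 != 0] in [A] too, and
    [n_integral_eigen_nz] applies. *)

(** The kernel form of Cramer's rule: [\adj N *m N = (\det N)%:M] turns
    [N *m w = 0] into [\det N *: w = 0]. *)
Lemma det_eq0_unimodular_ker (R : comPzRingType) (n : nat) (N : 'M[R]_n)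
    (w : 'cV[R]_n) (i0 : 'I_n) :
  w i0 0 = 1 -> N *m w = 0 -> \det N = 0.
Proof.
move=> w1 Nw0.
have: \adj N *m (N *m w) = 0 by rewrite Nw0 mulmx0.
rewrite mulmxA mul_adj_mx mul_scalar_mx => /matrixP/(_ i0 0).
by rewrite !mxE w1 mulr1.
Qed.

Lemma horner_char_poly (R : comNzRingType) (n : nat) (M : 'M[R]_n) (x : R) :
  (char_poly M).[x] = \det (x%:M - M).
Proof.
rewrite /char_poly -/(horner_eval x _) -det_map_mx; congr (\det _).
apply/matrixP=> i j; rewrite !mxE /= /horner_eval.
by rewrite !hornerE hornerMn hornerX.
Qed.

Lemma n_integral_eigen_nz (A B : comNzRingType) (f : {rmorphism A -> B})
    (n : nat) (M : 'M[A]_n) (w : 'cV[B]_n) (i0 : 'I_n) (u : B) :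
  w i0 0 = 1 -> map_mx f M *m w = u *: w -> n_integral f n u.
Proof.
move=> w1 Mw; apply/n_integralP; exists (char_poly M); split.
- exact: char_poly_monic.
- exact: size_char_poly.
apply/rootP; rewrite map_char_poly horner_char_poly.
apply: (@det_eq0_unimodular_ker _ _ _ w i0 w1).
by rewrite mulmxBl mul_scalar_mx Mw subrr.
Qed.

Lemma n_integral_trivial (A B : comPzRingType) (f : {rmorphism A -> B})
    (n : nat) (u : B) : 1 = 0 :> B -> n_integral f n u.
Proof.
move=> B0; exists (rcons (nseq n 0) 1).
  by split; rewrite ?size_rcons ?nth_rcons size_nseq // ltnn eqxx.
by rewrite -[LHS]mulr1 B0 mulr0.
Qed.

(** The determinant trick.  The vector [w] lists generators of a submodule
    stable under [u]; the entry [1] makes this submodule faithful. *)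
Lemma n_integral_eigen (A B : comPzRingType) (f : {rmorphism A -> B})
    (n : nat) (M : 'M[A]_n) (w : 'cV[B]_n) (i0 : 'I_n) (u : B) :
  w i0 0 = 1 -> map_mx f M *m w = u *: w -> n_integral f n u.
Proof.
have [B0 | B1] := eqVneq (1 : B) 0.
  by move=> _ _; exact: n_integral_trivial.
have A1 : (1 : A) != 0.
  by apply: contraNneq B1 => A0; rewrite -(rmorph1 f) A0 rmorph0.
pose A' : comNzRingType := HB.pack A
  (GRing.PzSemiRing_isNonZero.Build A A1).
pose B' : comNzRingType := HB.pack B
  (GRing.PzSemiRing_isNonZero.Build B B1).
exact: (@n_integral_eigen_nz A' B' f n M w i0 u).
Qed.

(** Collecting like powers, so that membership in the span of
    [1, v, ..., v ^+ n.-1] only requires a bound on the exponents. *)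
Lemma sum_powers_span (A B : comPzRingType) (f : {rmorphism A -> B})
    (n m : nat) (v : B) (b : 'I_m -> A) (e : 'I_m -> nat) :
  (forall i, (e i < n)%N) ->
  exists c : 'rV[A]_n,
    \sum_i f (b i) * v ^+ e i = \sum_l f (c 0 l) * v ^+ l.
Proof.
move=> lt_e_n; pose e' i := Ordinal (lt_e_n i).
exists (\row_l \sum_(i | e' i == l) b i).
rewrite (partition_big e' xpredT) //=; apply: eq_bigr => l _.
rewrite mxE rmorph_sum mulr_suml.
by apply: eq_bigr => i /eqP <-.
Qed.

Theorem theorem1p11 (A B : comPzRingType) (f : {rmorphism A -> B})
    (n : nat) (hn : (0 < n)%N) (v : B) (a : n.+1.-tuple A)
    (ha : \sum_(i < n.+1) f a`_i * v ^+ i = 0)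
    (k : nat) (hk : (k <= n)%N) :
  n_integral f n (\sum_(i < (n - k).+1) f a`_(i + k) * v ^+ i).
Proof.
set u := \sum_(i < _) _.
have vku : u * v ^+ k = \sum_(i < k) f (- a`_i) * v ^+ i.
  apply/eqP; rewrite -subr_eq0 -sumrN; apply/eqP; rewrite -[RHS]ha addrC.
  rewrite -!(big_mkord xpredT (fun i => f a`_i * v ^+ i)).
  rewrite (big_cat_nat _ (n := k)) ?leqW //=; congr (_ + _).
    by rewrite big_mkord; apply: eq_bigr => i _; rewrite rmorphN mulNr opprK.
  rewrite -{2}[k]add0n big_addn subSn // big_mkord mulr_suml.
  by apply: eq_bigr => i _; rewrite -mulrA -exprD.
have stable (j : 'I_n) : exists c : 'rV[A]_n,
    u * v ^+ j = \sum_l f (c 0 l) * v ^+ l.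
  have [lt_jk | le_kj] := ltnP j k.
    have [|c cE] := @sum_powers_span A B f n (n - k).+1 v
      (fun i => a`_(i + k)) (fun i => i + j)%N.
      move=> i; have := leq_add (ltnSE (ltn_ord i)) lt_jk.
      by rewrite subnK // addnS.
    exists c; rewrite -cE mulr_suml.
    by apply: eq_bigr => i _; rewrite -mulrA -exprD.
  have [|c cE] := @sum_powers_span A B f n k v
    (fun i => - a`_i) (fun i => i + (j - k))%N.
    move=> i; apply: leq_ltn_trans (ltn_ord j).
    by rewrite -{2}(subnKC le_kj) leq_add2r ltnW.
  exists c; rewrite -cE -{1}(subnKC le_kj) exprD mulrA vku mulr_suml.
  by apply: eq_bigr => i _; rewrite -mulrA -exprD.
have [c uv] := fin_all_exists stable.
apply: (@n_integral_eigen A B f n (\matrix_(j, l) c j 0 l)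
  (\col_j v ^+ j) (Ordinal hn)); first by rewrite mxE.
apply/matrixP=> j z; rewrite !mxE uv.
by apply: eq_bigr => l _; rewrite !mxE.
Qed.
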